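(* Let $k\ge 1$ and $m\ge 2$ be integers, and let $\epsilon_{ij}\in\{-1,0,1\}$ for $1\le i\le k$, $1\le j\le m$, be such that the equation system $$\epsilon_{i1}x_1+\cdots+\epsilon_{im}x_m=0,\qquad i=1,\ldots,k,$$ is graph-representable. There is a function $\delta'=\delta'(\delta)$ of $\delta>0$, depending only on $\delta$ and the system, with $\delta'(\delta)\to0$ as $\delta\to0^+$, such that the following holds for every $\delta>0$. Let $G$ be a finite abelian group (written additively) of order $N$ and let $A_1,\ldots,A_m$ be subsets of $G$. If the system has less than $\delta N^{m-k}$ solutions $(x_1,\ldots,x_m)$ in $G^m$ with $x_i\in A_i$ for all $i$, then there are subsets $A'_i\subseteq A_i$ with $|A_i\setminus A'_i|\le\delta' N$ for all $i=1,\ldots,m$ such that there is no solution of the system with $x_i\in A'_i$ for all $i$.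
   Context: Cycle space. Let $H$ be a directed graph with $m$ arcs, indexed by $1,\ldots,m$. Cycles of $H$ may traverse arcs in either direction. The characteristic vector of a cycle $C$ of $H$ is the $m$-dimensional vector whose $i$-th coordinate is $+1$ if the $i$-th arc is traversed by $C$ in its direction, $-1$ if it is traversed by $C$ in the reverse direction, and $0$ if it is not traversed by $C$. The cycle space of $H$ is the vector space over $\mathbb{Q}$ spanned by the characteristic vectors of the cycles of $H$. Integral generation. A set of integer vectors contained in the cycle space of $H$ integrally generates the cycle space of $H$ if the vectors are linearly independent and every integer vector of the cycle space is a linear combination of these vectors with integer coefficients. Graph-representability. The characteristic vector of the $i$-th equation is $(\epsilon_{i1},\ldots,\epsilon_{im})$. The system is graph-representable if there exists a directed graph $H$ with $m$ arcs, the $j$-th arc being associated with the variable $x_j$, such that the $k$ characteristic vectors of the equations integrally generate the cycle space of $H$ (in particular these $k$ vectors lie in the cycle space and are linearly independent). Asymptotics. The function $\delta'$ does not depend on $N$, on the structure of $G$, or on the sets $A_i$. This is the precise meaning of the formulation ''if the system has $o(N^{m-k})$ solutions with $x_i\in A_i$, then there are $A_i'\subseteq A_i$ with $|A_i\setminus A_i'|=o(N)$ such that there is no solution with $x_i\in A_i'$''. *)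

(* Defs.v *)
From HB Require Import structures.
From mathcomp Require Import all_boot all_algebra.

Set Implicit Arguments.
Unset Strict Implicit.
Unset Printing Implicit Defensive.

Import GRing.Theory Num.Theory.

Local Open Scope ring_scope.

(* Parallel, antiparallel and loop arcs are all allowed. *)
Record digraph (m : nat) := Digraph {
  vertex : finType;
  source : 'I_m -> vertex;
  target : 'I_m -> vertex
}.

(* (j, true) traverses the arc j in its direction, (j, false) in reverse. *)
Definition step (m : nat) : finType := ('I_m * bool)%type.

Definition step_from m (H : digraph m) (s : step m) : vertex H :=
  if s.2 then source H s.1 else target H s.1.

Definition step_to m (H : digraph m) (s : step m) : vertex H :=
  if s.2 then target H s.1 else source H s.1.

(* The distinctness of the arcs only matters for two steps: it excludes going
   back and forth along a single arc. *)
Definition is_cycle m (H : digraph m) (c : seq (step m)) : bool :=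
  [&& c != [::],
      cycle (fun s t => step_to H s == step_from H t) c,
      uniq [seq step_from H s | s <- c] &
      uniq [seq s.1 | s <- c]].

Definition char_vec m (c : seq (step m)) : 'rV[rat]_m :=
  \row_(j < m) (((j, true) \in c)%:R - ((j, false) \in c)%:R).

(* The arcs of a cycle are distinct, so every cycle has at most m steps;
   see cycle_spaceP. *)
Definition cycle_space m (H : digraph m) : {vspace 'rV[rat]_m} :=
  (\sum_(n < m.+1) \sum_(c : n.-tuple (step m) | is_cycle H c)
     <[char_vec c]>)%VS.

Lemma cycle_spaceP m (H : digraph m) (U : {vspace 'rV[rat]_m}) :
  reflect (forall c, is_cycle H c -> char_vec c \in U) (cycle_space H <= U)%VS.
Proof.
apply: (iffP subv_sumP) => [sub c cyc|sub n _]; last first.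
  by apply/subv_sumP => c cyc; rewrite -memvE; apply: sub.
have szc : (size c < m.+1)%N.
  have /and4P[_ _ _ /card_uniqP] := cyc.
  by rewrite size_map ltnS => <-; rewrite (leq_trans (max_card _)) ?card_ord.
have /subv_sumP sub1 := sub (Ordinal szc) isT.
by have := sub1 (in_tuple c) cyc; rewrite -memvE.
Qed.

Definition rat_vec m (v : 'rV[int]_m) : 'rV[rat]_m := map_mx intr v.

Definition integrally_generates m k (w : k.-tuple 'rV[int]_m)
    (U : {vspace 'rV[rat]_m}) : Prop :=
  [/\ forall i : 'I_k, rat_vec (tnth w i) \in U,
      free [seq rat_vec v | v <- w] &
      forall z : 'rV[int]_m, rat_vec z \in U ->
        exists a : 'I_k -> int, z = \sum_(i < k) a i *: tnth w i].

Definition graph_representable k m (eps : 'M[int]_(k, m)) : Prop :=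
  exists H : digraph m,
    integrally_generates [tuple row i eps | i < k] (cycle_space H).

Definition solutions k m (eps : 'M[int]_(k, m)) (G : finZmodType)
    (A : 'I_m -> {set G}) : {set {ffun 'I_m -> G}} :=
  [set x : {ffun 'I_m -> G} |
    [forall j, x j \in A j] && [forall i, \sum_(j < m) x j *~ eps i j == 0]].

(* Main.v *)
Require Import Defs.
From HB Require Import structures.
From mathcomp Require Import all_boot all_order all_algebra.
From mathcomp Require Import all_classical all_reals all_analysis.
From mathcomp Require Import archimedean ring lra.
From mathcomp Require Import fintype finset.

Set Implicit Arguments.
Unset Strict Implicit.
Unset Printing Implicit Defensive.

Import Order.TTheory GRing.Theory Num.Theory.
Import numFieldNormedType.Exports.

(** The rows of [eps] generate the cycle space of a digraph [H], so the solutions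
of the system in an abelian group [G] are exactly the vectors of differences
[x j = g (target j) - g (source j)] of functions [g : vertex H -> G], called
potentials below.  A vector of differences is killed by every vector that is
conserved at each vertex, and the cycle space consists of such vectors
([cycle_space_conserved], [solution_of_potential]).  Conversely, integral
generation makes the characteristic vector of a cycle an integer combination of
the equations, so a solution sums to zero along every cycle, and then it has a
potential ([exists_potential]).  As all solutions have equally many potentials,
the hypothesis says that fewer than a fraction [delta] of all maps from the
vertices to [G] have their differences in the sets [A j] ([potentials_lt]).

Such a map is a homomorphic copy of [H] in the graph on [G] in which the arc [j]
may be placed on the pairs [(a, a + y)] with [y] in [A j].  The removal lemma for
graphs ([removal]) gives a set of [o(N ^ 2)] pairs for each arc that together meet
all copies.  An element [y] is then deleted from [A j] when a constant fraction
of the [N] pairs of difference [y] has been removed; there are [o(N)] such [y].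
If a solution survived, the [N] translates of its potential would be [N] copies
which use pairwise distinct pairs for each arc, and the removed pairs would be
too few to meet all of them ([difference_removal]).

The removal lemma is proved by regularity.  The vertex set is partitioned so that
for each arc almost all pairs of cells are regular ([szemeredi_regularity]).
Regularity is used in the form of a cut norm bound: on subsets of the two cells
the number of pairs differs from its expected value by at most [eps] times the
number of all pairs of the cells.  In this form the counting lemma
([counting_seq]) replaces one relation at a time by its density.  The pairs lying
in irregular, sparse or small cells are removed; a copy that survives lies in
large, dense, regular cells, which would contain too many copies.

The counting lemma needs a graph without loops and parallel arcs.  A loop only
asks whether [0] belongs to its set, and parallel arcs are merged into one edge
with the intersection of their sets ([system_removal]). *)

Local Open Scope ring_scope.

(** * Averages over the classes of a labelling *)

Section Mean.
Variables (R : realFieldType) (Z : finType).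

(** The conditional expectation of [f] given the label; on an empty class it is
[0], as [x / 0 = 0]. *)
Definition mean (L : finType) (C : Z -> L) (f : Z -> R) (a : L) : R :=
  (\sum_(z | C z == a) f z) / #|[set z | C z == a]|%:R.

Definition energy (L : finType) (C : Z -> L) (f : Z -> R) : R :=
  \sum_z mean C f (C z) ^+ 2.

Lemma sum_fiber_mean (L : finType) (C : Z -> L) f a :
  \sum_(z | C z == a) mean C f a = \sum_(z | C z == a) f z.
Proof.
rewrite sumr_const -[in LHS]mulr_natr /mean.
rewrite [X in _ / X%:R * _](_ : _ = #|[pred z | C z == a]|); last first.
  by apply: eq_card => z; rewrite !inE.
have [c0|c_neq0] := eqVneq #|[pred z | C z == a]| 0%N; last first.
  by rewrite divfK // pnatr_eq0.
rewrite c0 mulr0 big_pred0 // => z.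
by have := card0_eq c0 z; rewrite !inE.
Qed.

(** Averaging is the orthogonal projection onto the functions of the label. *)
Lemma sum_mean_mul (L : finType) (C : Z -> L) f (h : L -> R) :
  \sum_z mean C f (C z) * h (C z) = \sum_z f z * h (C z).
Proof.
rewrite (partition_big C xpredT) //= [RHS](partition_big C xpredT) //=.
apply: eq_bigr => a _.
transitivity ((\sum_(z | C z == a) mean C f a) * h a).
  by rewrite mulr_suml; apply: eq_bigr => z /eqP->.
by rewrite sum_fiber_mean mulr_suml; apply: eq_bigr => z /eqP->.
Qed.

Lemma mean_ge0 (L : finType) (C : Z -> L) f a :
  (forall z, 0 <= f z) -> 0 <= mean C f a.
Proof. by move=> f0; rewrite divr_ge0 ?ler0n ?sumr_ge0. Qed.

Lemma mean_le1 (L : finType) (C : Z -> L) f a :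
  (forall z, f z <= 1) -> mean C f a <= 1.
Proof.
move=> f1; rewrite /mean.
have [->|c_neq0] := eqVneq #|[set z | C z == a]| 0%N.
  by rewrite invr0 mulr0.
rewrite ler_pdivrMr ?ltr0n ?lt0n // mul1r -sumr_const.
rewrite [leRHS](eq_bigl (fun z => C z == a)); last by move=> z; rewrite inE.
exact: ler_sum.
Qed.

Lemma energy_le_card (L : finType) (C : Z -> L) f :
  (forall z, 0 <= f z <= 1) -> energy C f <= #|Z|%:R.
Proof.
move=> f01; rewrite -sumr_const; apply: ler_sum => z _.
by rewrite expr_le1 ?mean_le1 ?mean_ge0 // => w; have /andP[] := f01 w.
Qed.

Lemma energy_ge0 (L : finType) (C : Z -> L) f : 0 <= energy C f.
Proof. by apply: sumr_ge0 => z _; apply: sqr_ge0. Qed.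

(** The deviation of [f] from its mean on [S] is also the deviation of the finer
mean, because [S] is a union of classes of [C'].  Expanding the square of the
difference of the two means, minus [+- eps] times the indicator of [S], bounds
the sum of squares below. *)
Lemma sqr_deviation_ge (L L' : finType) (C : Z -> L) (C' : Z -> L') f (eps : R) a
    (S : {set Z}) (sigma : pred L') :
    0 <= eps ->
    (forall z, (z \in S) = sigma (C' z)) ->
    (forall z, z \in S -> C z = a) ->
    eps * #|[set z | C z == a]|%:R < `|\sum_(z in S) (f z - mean C f a)| ->
  eps ^+ 2 * #|[set z | C z == a]|%:R <=
    \sum_(z | C z == a) (mean C' f (C' z) - mean C f (C z)) ^+ 2.
Proof.
move=> eps0 Ssig Sa; set n := #|_|%:R; set U := \sum_(z in S) _ => ltU.
pose u z := mean C' f (C' z) - mean C f (C z).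
have sumu : \sum_(z in S) u z = U.
  rewrite /U !sumrB.
  rewrite [X in _ - X](eq_bigr (fun=> mean C f a)) => [|z /Sa->//].
  have inS (F : Z -> R) : \sum_(z in S) F z = \sum_z F z * (sigma (C' z))%:R.
    by rewrite big_mkcond; apply: eq_bigr => z _; rewrite -Ssig mulr_natr mulrb.
  by rewrite !inS (sum_mean_mul C' f (fun b => (sigma b)%:R)) -!inS.
have leSn : #|S|%:R <= n.
  by rewrite ler_nat; apply/subset_leq_card/subsetP => z /Sa; rewrite inE => ->.
(* The sign of [t] is chosen as that of [U]. *)
have key (t : R) : t ^+ 2 = eps ^+ 2 -> 0 <= t * U ->
    eps ^+ 2 * n <= \sum_(z | C z == a) u z ^+ 2.
  move=> t2 tU0.
  have tU : eps * (eps * n) <= t * U.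
    have -> : t * U = eps * `|U|.
      rewrite -(ger0_norm tU0) normrM; congr (_ * _).
      by apply/eqP; rewrite -(@eqrXn2 _ 2%N) // real_normK ?t2 ?num_real.
    by rewrite ler_wpM2l // ltW.
  have : 0 <= \sum_(z | C z == a) (u z - t * (z \in S)%:R) ^+ 2.
    by apply: sumr_ge0 => z _; apply: sqr_ge0.
  have -> : \sum_(z | C z == a) (u z - t * (z \in S)%:R) ^+ 2 =
      \sum_(z | C z == a) u z ^+ 2 - (t * U) *+ 2 + t ^+ 2 * #|S|%:R.
    rewrite (eq_bigr (fun z => u z ^+ 2 - (t *+ 2) * (if z \in S then u z else 0)
        + t ^+ 2 * (if z \in S then 1 else 0))); last first.
      by move=> z _; case: (z \in S); rewrite /= ?mulr1n ?mulr0n mulr2n; ring.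
    have inS (F : Z -> R) : \sum_(z | C z == a) (if z \in S then F z else 0) =
        \sum_(z in S) F z.
      rewrite -big_mkcondr; apply: eq_bigl => z.
      by apply/andP/idP => [[]//|Sz]; rewrite Sz (Sa z Sz).
    rewrite big_split sumrB /= -!mulr_sumr !inS sumu sumr_const.
    by rewrite !mulr2n; ring.
  rewrite t2 => ge0.
  have : eps ^+ 2 * #|S|%:R <= eps ^+ 2 * n by rewrite ler_wpM2l ?sqr_ge0.
  rewrite mulrA -expr2 in tU; move: ge0 tU.
  by rewrite mulr2n; lra.
have [U0|/ltW U0] := lerP 0 U; first by apply: (key eps) => //; rewrite mulr_ge0.
by apply: (key (- eps)); rewrite ?sqrrN // mulNr -mulrN mulr_ge0 // oppr_ge0.
Qed.

Section Refinement.
Variables (L L' : finType) (C : Z -> L) (C' : Z -> L') (pi : L' -> L).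
Hypothesis piC : forall z, C z = pi (C' z).

(** Pythagoras: the coarse mean is the projection of the fine one. *)
Lemma energy_refine f :
  energy C' f = energy C f + \sum_z (mean C' f (C' z) - mean C f (C z)) ^+ 2.
Proof.
have dot : \sum_z mean C' f (C' z) * mean C f (C z) = energy C f.
  under eq_bigr do rewrite piC.
  rewrite (sum_mean_mul C' f (fun b => mean C f (pi b))).
  under eq_bigr do rewrite -piC.
  by rewrite -sum_mean_mul; apply: eq_bigr => z _; rewrite expr2.
under [X in _ + X]eq_bigr do rewrite sqrrB.
rewrite big_split sumrB /= -/(energy C' f) -/(energy C f) sumrMnl dot.
by rewrite mulr2n; ring.
Qed.

Lemma energy_mono f : energy C f <= energy C' f.
Proof.
by rewrite energy_refine lerDl sumr_ge0 // => z _; apply: sqr_ge0.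
Qed.

End Refinement.
End Mean.

(** * The regularity lemma *)

Section Regularity.
Variables (R : realFieldType) (X : finType).

Definition ind (F : rel X) (z : X * X) : R := (F z.1 z.2)%:R.

Lemma ind01 F z : 0 <= ind F z <= 1.
Proof. by rewrite /ind; case: (F _ _); rewrite ?lexx ler01. Qed.

(** A bound on the cut norm of [ind F - d] on the two sets: [S] and [U] may have any
size because the error is measured against the whole of [A] and [B]. *)
Definition regular_pair (F : rel X) (eps d : R) (A B : {set X}) : bool :=
  [forall S : {set X}, forall U : {set X}, (S \subset A) ==> (U \subset B) ==>
    (`|\sum_(z in setX S U) (ind F z - d)| <= eps * #|setX A B|%:R)].

Section Labelling.
Variables (T : finType) (c : X -> T).

Definition cell (a : T) : {set X} := [set x | c x == a].

Definition label2 (z : X * X) : T * T := (c z.1, c z.2).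

Definition density (F : rel X) (a b : T) : R := mean label2 (ind F) (a, b).

Definition irregular_pairs (eps : R) (F : rel X) : {set X * X} :=
  [set z | ~~ regular_pair F eps (density F (c z.1) (c z.2))
                           (cell (c z.1)) (cell (c z.2))].

Lemma cell_label2 a b : [set z | label2 z == (a, b)] = setX (cell a) (cell b).
Proof. by apply/setP => z; rewrite !inE xpair_eqE. Qed.

Lemma density_ge0 F a b : 0 <= density F a b.
Proof. by apply: mean_ge0 => z; have /andP[] := ind01 F z. Qed.

Lemma density_le1 F a b : density F a b <= 1.
Proof. by apply: mean_le1 => z; have /andP[] := ind01 F z. Qed.

End Labelling.

(** The refinement remembers, for each pair of cells, the membership in two sets
witnessing its irregularity for [j].  By [sqr_deviation_ge] the energy of [F j]
grows by at least [eps ^+ 2] times the number of pairs in irregular cells, and no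
other energy decreases. *)
Lemma refine_irregular (J T : finType) (F : J -> rel X) (c : X -> T) (j : J)
    (eps : R) :
    0 < eps -> eps * #|{: X * X}|%:R < #|irregular_pairs c eps (F j)|%:R ->
  exists (T' : finType) (c' : X -> T'),
    #|T'| = (#|T| * 4 ^ (#|T| * #|T|))%N /\
    \sum_i energy (label2 c) (ind (F i)) + eps ^+ 3 * #|{: X * X}|%:R
      <= \sum_i energy (label2 c') (ind (F i)).
Proof.
move=> eps0 irr.
pose deviates (ab : T * T) (w : {set X} * {set X}) :=
  [&& w.1 \subset cell c ab.1, w.2 \subset cell c ab.2 &
    eps * #|setX (cell c ab.1) (cell c ab.2)|%:R
      < `|\sum_(z in setX w.1 w.2) (ind (F j) z - density c (F j) ab.1 ab.2)|].
pose W ab := odflt (set0, set0) [pick w | deviates ab w].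
have devW z : z \in irregular_pairs c eps (F j) -> deviates (label2 c z) (W (label2 c z)).
  rewrite inE negb_forall => /existsP[S]; rewrite negb_forall => /existsP[U].
  rewrite !negb_imply -ltNge => dev.
  by rewrite /W; case: pickP => [w //|/(_ (S, U))]; rewrite /deviates /= dev.
pose c' x : T * {ffun T * T -> bool * bool} :=
  (c x, [ffun ab => (x \in (W ab).1, x \in (W ab).2)]).
exists (T * {ffun T * T -> bool * bool})%type, c'; split.
  by rewrite card_prod card_ffun !card_prod card_bool.
pose pi2 (ab : (T * {ffun T * T -> bool * bool}) * (T * {ffun T * T -> bool * bool})) :=
  (ab.1.1, ab.2.1).
have piC z : label2 c z = pi2 (label2 c' z) by [].
rewrite (bigD1 j) //= [leRHS](bigD1 j) //= addrAC lerD //; last first.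
  by apply: ler_sum => i _; apply: energy_mono piC _.
rewrite (energy_refine piC) lerD2l.
pose u z := (mean (label2 c') (ind (F j)) (label2 c' z)
             - mean (label2 c) (ind (F j)) (label2 c z)) ^+ 2.
rewrite (_ : \sum_z _ = \sum_z u z) //.
apply: (@le_trans _ _ (\sum_(z in irregular_pairs c eps (F j)) u z)); last first.
  rewrite [leRHS](bigID [in irregular_pairs c eps (F j)]) /= lerDl.
  by apply: sumr_ge0 => z _; apply: sqr_ge0.
apply: (@le_trans _ _ (\sum_(z in irregular_pairs c eps (F j)) eps ^+ 2)).
  rewrite sumr_const -[leRHS]mulr_natr exprSr -mulrA ler_wpM2l ?sqr_ge0 //.
  exact: ltW.
pose bad ab := ~~ regular_pair (F j) eps (density c (F j) ab.1 ab.2)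
                 (cell c ab.1) (cell c ab.2).
have irrE z : (z \in irregular_pairs c eps (F j)) = bad (label2 c z).
  by rewrite inE.
rewrite (partition_big (label2 c) bad) => [|z]; last by rewrite irrE.
rewrite [leRHS](partition_big (label2 c) bad) => [|z]; last by rewrite irrE.
apply: ler_sum => -[a b] badab.
have fiberE z : (z \in irregular_pairs c eps (F j)) && (label2 c z == (a, b))
    = (label2 c z == (a, b)).
  by rewrite irrE andb_idl // => /eqP->.
rewrite !(eq_bigl _ _ fiberE) sumr_const.
rewrite -[X in X <= _]mulr_natr.
have [z0 z0ab|noz] := pickP (fun z => label2 c z == (a, b)); last first.
  by rewrite !big_pred0 // (eq_card0 noz) mulr0.
have := devW z0; rewrite irrE (eqP z0ab) => /(_ badab) /and3P[/= SA UB dev].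
rewrite [X in X%:R](_ : _ = #|[set z | label2 c z == (a, b)]|); last first.
  by apply: eq_card => z; rewrite inE.
pose sigma (p : (T * {ffun T * T -> bool * bool}) * (T * {ffun T * T -> bool * bool})) :=
  (p.1.2 (a, b)).1 && (p.2.2 (a, b)).2.
apply: (@sqr_deviation_ge _ _ _ _ _ _ _ _ _ (setX (W (a, b)).1 (W (a, b)).2) sigma).
- exact: ltW.
- by move=> z; rewrite /sigma /= !ffunE inE.
- move=> z; rewrite inE => /andP[/(subsetP SA) + /(subsetP UB)].
  by rewrite !inE /label2 => /eqP-> /eqP->.
- by rewrite cell_label2.
Qed.

End Regularity.

(** The total energy is at most [#|J| * #|X| ^ 2] and each refinement of an
irregular labelling adds [eps ^+ 3 * #|X| ^ 2], so at most [#|J| / eps ^+ 3]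
refinements are possible.  The bound [M] is obtained by iterating the growth of
the number of labels. *)
Theorem szemeredi_regularity (R : archiRealFieldType) (J : finType) (eps : R) :
    0 < eps ->
  exists M : nat, forall (X : finType) (F : J -> rel X),
    exists (T : finType) (c : X -> T), (#|T| <= M)%N /\
      forall j, #|irregular_pairs c eps (F j)|%:R <= eps * #|{: X * X}|%:R.
Proof.
move=> eps0.
pose grow n := (n * 4 ^ (n * n))%N.
have growS m n : (m <= n)%N -> (grow m <= grow n)%N.
  by move=> mn; rewrite leq_mul // leq_exp2l // leq_mul.
have leg n : (n <= grow n)%N by rewrite leq_pmulr ?expn_gt0.
pose K := Num.bound (#|J|%:R / eps ^+ 3).
exists (iter K.+1 grow 1%N) => X F.
have [X0|X0] := posnP #|{: X * X}|.
  exists unit, (fun=> tt); split; last first.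
    move=> j; rewrite X0 mulr0 (_ : #|_| = 0%N) //.
    by apply/eqP; rewrite -leqn0 -X0 max_card.
  rewrite card_unit; elim: (K.+1) => //= n IH; exact: leq_trans (leg _).
have step n : (exists (T : finType) (c : X -> T), (#|T| <= iter n grow 1)%N /\
      forall j, #|irregular_pairs c eps (F j)|%:R <= eps * #|{: X * X}|%:R) \/
    (exists (T : finType) (c : X -> T), (#|T| <= iter n grow 1)%N /\
      n%:R * (eps ^+ 3 * #|{: X * X}|%:R) <=
        \sum_i energy (label2 c) (ind R (F i))).
  elim: n => [|n [[T [c [leT reg]]]|[T [c [leT en]]]]].
  - right; exists unit, (fun=> tt); rewrite card_unit /=; split=> //.
    by rewrite mul0r sumr_ge0 // => i _; apply: energy_ge0.
  - by left; exists T, c; split=> //; apply: leq_trans (leg _).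
  have [reg|] := boolP [forall j,
      #|irregular_pairs c eps (F j)|%:R <= eps * #|{: X * X}|%:R].
    left; exists T, c; split; first exact: leq_trans (leg _).
    exact/forallP.
  rewrite negb_forall => /existsP[j]; rewrite -ltNge.
  move=> /(refine_irregular eps0)[T' [c' [cardT' en']]].
  right; exists T', c'; split; first by rewrite cardT' growS.
  apply: le_trans en'; rewrite -natr1 mulrDl mul1r.
  by rewrite lerD2r.
have [//|[T [c [_]]]] := step K.+1.
have enX : \sum_i energy (label2 c) (ind R (F i)) <= #|J|%:R * #|{: X * X}|%:R.
  apply: (@le_trans _ _ (\sum_(i : J) #|{: X * X}|%:R)).
    by apply: ler_sum => i _; apply: energy_le_card => z; apply: ind01.
  by rewrite sumr_const mulr_natl.
move=> /le_trans/(_ enX).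
rewrite mulrA ler_pM2r ?ltr0n // -ler_pdivlMr ?exprn_gt0 // leNgt.
have Kgt : #|J|%:R / eps ^+ 3 < K%:R.
  by apply: archi_boundP; rewrite divr_ge0 ?exprn_ge0 // ltW.
by rewrite (lt_le_trans Kgt) // ler_nat.
Qed.

(** * The counting lemma *)

(** The second condition forbids two arcs with the same pair of ends, in either
direction. *)
Definition simple_arcs (V J : finType) (s t : J -> V) : Prop :=
  (forall j, s j != t j) /\
  (forall i j, i != j -> ~~ ((s i \in [set s j; t j]) && (t i \in [set s j; t j]))).

Definition arcs_hold (V J X : finType) (s t : J -> V) (F : J -> rel X)
    (g : {ffun V -> X}) (j : J) : bool :=
  F j (g (s j)) (g (t j)).

Definition update (V X : finType) (g : {ffun V -> X}) (v : V) (x : X) : {ffun V -> X} :=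
  [ffun w => if w == v then x else g w].

Section Counting.
Variables (R : realFieldType) (V X : finType).
Implicit Types (A : V -> {set X}) (g : {ffun V -> X}).

Lemma update_family A g v x :
  g \in family A -> x \in A v -> update g v x \in family A.
Proof.
move=> /familyP gA xA; apply/familyP => w; rewrite ffunE.
by case: eqP => [->//|_]; apply: gA.
Qed.

(** Exchanging [x] with the old value [g v] is an involution of the pairs
[(g, x)]. *)
Lemma sum_update A (Phi : {ffun V -> X} -> R) v :
  \sum_(g in family A) \sum_(x in A v) Phi (update g v x)
    = #|A v|%:R * \sum_(g in family A) Phi g.
Proof.
rewrite mulr_sumr pair_big_dep /=.
rewrite [RHS](eq_bigr (fun g => \sum_(x in A v) Phi g)) => [|g _]; last first.
  by rewrite sumr_const mulr_natl.
rewrite [RHS]pair_big_dep /=.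
pose h (p : {ffun V -> X} * X) := (update p.1 v p.2, p.1 v).
have hK : involutive h.
  move=> [g x]; rewrite /h /= ffunE eqxx; congr pair.
  by apply/ffunP => w; rewrite !ffunE; case: eqP => [->|].
rewrite [RHS](reindex_inj (inv_inj hK)) /=; apply: eq_bigl => -[g x] /=.
apply/andP/andP => -[gA xA].
  by split; [apply: update_family|have /familyP := gA; apply].
have xAv : x \in A v by have /familyP/(_ v) := gA; rewrite ffunE eqxx.
split=> //; apply/familyP => w; case: (eqVneq w v) => [->//|wv].
by have /familyP/(_ w) := gA; rewrite ffunE (negPf wv).
Qed.

Variables (J : finType) (s t : J -> V) (F : J -> rel X) (A : V -> {set X}).
Variables (d : J -> R) (eps : R).
Hypothesis simple : simple_arcs s t.
Hypothesis d01 : forall j, 0 <= d j <= 1.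
Hypothesis reg : forall j, regular_pair (F j) eps (d j) (A (s j)) (A (t j)).

Lemma card_family_prod : #|family A| = (\prod_v #|A v|)%N.
Proof.
by rewrite card_family foldrE big_map big_enum.
Qed.

(** Only the values [x] and [y] of the map at the ends of [j] vary.  As no other arc
joins these ends, each further condition depends on [x] alone or on [y] alone;
so the conditions cut out a product set [setX S U], on which regularity applies. *)
Lemma sum_deviation_local (j : J) (r : seq J) g : j \notin r ->
  `|\sum_(x in A (s j)) \sum_(y in A (t j))
      (ind R (F j) (x, y) - d j) *
      (all (arcs_hold s t F (update (update g (s j) x) (t j) y)) r)%:R|
    <= eps * #|setX (A (s j)) (A (t j))|%:R.
Proof.
move=> jr; have [stj sep] := simple.
(* The arcs at [t j] are put into [U], all others into [S]. *)
pose at_t i := t j \in [set s i; t i].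
pose S := [set x in A (s j) |
  all (fun i => ~~ at_t i ==> arcs_hold s t F (update g (s j) x) i) r].
pose U := [set y in A (t j) |
  all (fun i => at_t i ==> arcs_hold s t F (update g (t j) y) i) r].
have SA : S \subset A (s j) by apply/subsetP => x; rewrite inE => /andP[].
have UA : U \subset A (t j) by apply/subsetP => x; rewrite inE => /andP[].
have /forallP/(_ S)/forallP/(_ U) := reg j.
rewrite SA UA /=; apply: le_trans; rewrite le_eqVlt; apply/orP; left; apply/eqP.
congr `|_|; rewrite pair_big_dep /=.
rewrite [RHS]big_mkcond [LHS]big_mkcond /=; apply: eq_bigr => -[x y] _ /=.
rewrite !inE /=.
case: (x \in A (s j)) => //=; case: (y \in A (t j)) => //=; last by rewrite andbF.
set g' := update _ _ _.
rewrite (_ : all _ r && all _ r = all (arcs_hold s t F g') r).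
  by case: all; rewrite ?mulr1 ?mulr0.
rewrite -all_predI; apply: eq_in_all => i ir /=.
have ij : i != j by apply: contraNneq jr => <-.
rewrite /arcs_hold /g' !ffunE.
have [ti|ti] := boolP (at_t i) => /=; last first.
  rewrite andbT; move: ti; rewrite /at_t !inE negb_or !(eq_sym (t j)).
  by case/andP => /negPf-> /negPf->.
have si : (s j != s i) && (s j != t i).
  have := sep j i; rewrite eq_sym ij => /(_ isT).
  by rewrite -/(at_t i) ti andbT !inE negb_or.
move: si; rewrite !(eq_sym (s j)) => /andP[/negPf-> /negPf->].
by [].
Qed.

(** Averaging the values at the ends of [j] over the cells reduces this to
[sum_deviation_local]. *)
Lemma sum_deviation_le (j : J) (r : seq J) : j \notin r ->
  `|\sum_(g in family A)
      (ind R (F j) (g (s j), g (t j)) - d j) * (all (arcs_hold s t F g) r)%:R|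
    <= eps * (\prod_v #|A v|)%:R.
Proof.
move=> jr.
have [stj _] := simple.
have [P0|] := eqVneq (\prod_v #|A v|)%N 0%N.
  rewrite P0 mulr0 big_pred0 ?normr0 //.
  by apply/card0_eq; rewrite card_family_prod.
rewrite -lt0n => /gt0_prodn A0.
have c0 : 0 < #|A (s j)|%:R * #|A (t j)|%:R :> R by rewrite mulr_gt0 ?ltr0n ?A0.
rewrite -(ler_pM2l c0) -[X in X * `|_|]gtr0_norm // -normrM -mulrA.
rewrite -!sum_update; apply: le_trans (ler_norm_sum _ _ _) _.
rewrite [leRHS](_ : _ = \sum_(g in family A) eps * #|setX (A (s j)) (A (t j))|%:R).
  2: by rewrite sumr_const card_family_prod cardsX natrM -[RHS]mulr_natr; ring.
apply: ler_sum => g _.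
rewrite (eq_bigr (fun x => \sum_(y in A (t j)) (ind R (F j) (x, y) - d j) *
   (all (arcs_hold s t F (update (update g (s j) x) (t j) y)) r)%:R)).
  exact: sum_deviation_local.
move=> x _; apply: eq_bigr => y _; rewrite !ffunE !eqxx.
by rewrite (negPf (stj j)).
Qed.

(** Telescoping: replacing the relation of one arc by its density costs at most
[eps] times the number of all maps, by [sum_deviation_le]. *)
Lemma counting_seq (r : seq J) : uniq r ->
  `|\sum_(g in family A) (all (arcs_hold s t F g) r)%:R
     - (\prod_(j <- r) d j) * (\prod_v #|A v|)%:R|
    <= (size r)%:R * (eps * (\prod_v #|A v|)%:R).
Proof.
elim: r => [|j r IH] /= => [_|/andP[jr /IH{}IH]].
  by rewrite big_nil sumr_const card_family_prod mul1r subrr normr0 mul0r.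
rewrite (eq_bigr (fun g : {ffun V -> X} =>
   (ind R (F j) (g (s j), g (t j)) - d j) * (all (arcs_hold s t F g) r)%:R
   + d j * (all (arcs_hold s t F g) r)%:R)); last first.
  by move=> g _; rewrite -mulrDl subrK -mulnb natrM.
rewrite big_split -mulr_sumr big_cons -mulrA /= -addrA -mulrBr.
rewrite -natr1 mulrDl mul1r addrC.
have /andP[d0 d1] := d01 j.
apply: le_trans (ler_normD _ _) _.
rewrite lerD ?sum_deviation_le // normrM (ger0_norm d0).
by apply: le_trans IH; rewrite ler_piMl.
Qed.

Lemma counting :
  (\prod_j d j - #|J|%:R * eps) * (\prod_v #|A v|)%:R
    <= #|[set g in family A | [forall j, arcs_hold s t F g j]]|%:R.
Proof.
have := counting_seq (enum_uniq J).
rewrite -cardE big_enum /= ler_norml => /andP[lo _].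
rewrite -sum1dep_card natr_sum big_mkcondr /=.
rewrite (eq_bigr (fun g => (all (arcs_hold s t F g) (enum J))%:R)); last first.
  move=> g _; rewrite (_ : all _ _ = [forall j, arcs_hold s t F g j]).
    by case: forallP.
  apply/allP/forallP => h j; first by apply: h; rewrite mem_enum.
  by move=> _; apply: h.
by move: lo; rewrite mulrBl mulrA; lra.
Qed.

End Counting.

(** * The removal lemma for graphs *)

Section Cleaning.
Variables (R : realFieldType) (X T : finType) (c : X -> T).

(** Being in a sparse pair of cells depends only on the labels, so in the count
the relation may be replaced by its density. *)
Lemma card_sparse_le (F : rel X) (tau : R) : 0 <= tau ->
  #|[set z | F z.1 z.2 && (density R c F (c z.1) (c z.2) < tau)]|%:R
    <= tau * #|{: X * X}|%:R.
Proof.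
move=> tau0.
pose low (ab : T * T) := density R c F ab.1 ab.2 < tau.
rewrite -sum1dep_card natr_sum big_mkcond /=.
rewrite (eq_bigr (fun z => ind R F z * (low (label2 c z))%:R)); last first.
  by move=> z _; rewrite /ind /low /= -natrM mulnb; case: (_ && _).
rewrite -(sum_mean_mul (label2 c) (ind R F) (fun ab => (low ab)%:R)).
rewrite mulr_natr -sumr_const; apply: ler_sum => z _.
rewrite -[mean _ _ _]/(density R c F (c z.1) (c z.2)) /low /=.
by have [lt|le] := ltP; rewrite ?mulr1 ?mulr0 // ltW.
Qed.

Lemma card_small_le (beta : R) : 0 <= beta ->
  #|[set x | #|cell c (c x)|%:R < beta]|%:R <= #|T|%:R * beta.
Proof.
move=> beta0.
rewrite -sum1dep_card (partition_big c (fun a => #|cell c a|%:R < beta)) //=.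
rewrite natr_sum mulr_natl -sumr_const big_mkcond /=; apply: ler_sum => a _.
case: ifP => // /ltW; apply: le_trans; rewrite ler_nat sum1dep_card.
by apply/subset_leq_card/subsetP => x; rewrite !inE => /andP[].
Qed.

End Cleaning.

(** The constants: [tau] is a quarter of [eps] (for [eps] at most [1]), one for each
of the four kinds of removed pairs; [eta] is so small that the error of the counting lemma is at most half of
its main term [tau ^+ #|J|]; and [beta] is such that all cells smaller than
[beta * #|X|] together have at most [tau * #|X|] elements. *)
Theorem removal (R : archiRealFieldType) (V J : finType) (s t : J -> V) (eps : R) :
    simple_arcs s t -> 0 < eps ->
  exists2 delta : R, 0 < delta & forall (X : finType) (F : J -> rel X),
    #|[set g : {ffun V -> X} | [forall j, arcs_hold s t F g j]]|%:R
      < delta * #|X|%:R ^+ #|V| ->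
    exists D : J -> {set X * X},
      (forall j, #|D j|%:R <= eps * #|{: X * X}|%:R) /\
      forall g : {ffun V -> X}, (forall j, arcs_hold s t F g j) ->
        exists j, (g (s j), g (t j)) \in D j.
Proof.
move=> simple eps0.
pose tau := Num.min eps 1 / 4.
have tau0 : 0 < tau by rewrite divr_gt0 // lt_min eps0 ltr01.
have tau_eps : tau * 4 <= eps by rewrite /tau divfK ?pnatr_eq0 // ge_min lexx.
have tau1 : tau <= 1.
  by rewrite ler_pdivrMr // mul1r (@le_trans _ _ 1) ?ge_min ?lexx ?orbT ?ler1n.
pose eta := Num.min tau (tau ^+ #|J| / (2 * (#|J|.+1)%:R)).
have eta0 : 0 < eta.
  by rewrite lt_min tau0; apply: divr_gt0; rewrite ?exprn_gt0 // mulr_gt0 ?ltr0n.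
have eta_tau : eta <= tau by rewrite ge_min lexx.
have eta_count : #|J|%:R * eta <= tau ^+ #|J| / 2.
  apply: (@le_trans _ _ (#|J|.+1%:R * (tau ^+ #|J| / (2 * (#|J|.+1)%:R)))).
    by rewrite ler_pM ?ler0n ?(ltW eta0) ?ler_nat ?ge_min ?lexx ?orbT.
  have : #|J|.+1%:R != 0 :> R by rewrite pnatr_eq0.
  move: (_.+1%:R) => n n0.
  by rewrite le_eqVlt; apply/orP; left; apply/eqP; field.
have [M reg] := szemeredi_regularity J eta0.
pose beta := tau / M.+1%:R.
have beta0 : 0 < beta by rewrite divr_gt0 ?ltr0n.
have beta1 : beta <= 1.
  by rewrite ler_pdivrMr ?ltr0n // mul1r (le_trans tau1) // ler1n.
exists (tau ^+ #|J| / 2 * beta ^+ #|V|).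
  by rewrite mulr_gt0 ?exprn_gt0 // divr_gt0 ?exprn_gt0.
move=> X F few.
have [T [c [leTM irr]]] := reg X F.
pose small := [set x : X | #|cell c (c x)|%:R < beta * #|X|%:R].
pose sparse j := [set z : X * X |
  F j z.1 z.2 && (density R c (F j) (c z.1) (c z.2) < tau)].
exists (fun j => irregular_pairs c eta (F j) :|: sparse j
   :|: (setX small [set: X] :|: setX [set: X] small)); split=> [j|g holds].
  have small_le : #|small|%:R <= tau * #|X|%:R.
    apply: le_trans (card_small_le c _) _; first by rewrite mulr_ge0 ?ler0n // ltW.
    rewrite mulrA ler_wpM2r ?ler0n // /beta mulrCA ler_piMr ?(ltW tau0) //.
    by rewrite ler_pdivrMr ?ltr0n // mul1r ler_nat ltnW.
  have XX : #|{: X * X}|%:R = #|X|%:R * #|X|%:R :> R by rewrite card_prod natrM.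
  have side1 : #|setX small [set: X]|%:R <= tau * #|{: X * X}|%:R.
    by rewrite cardsX cardsT natrM XX mulrA ler_wpM2r ?ler0n.
  have side2 : #|setX [set: X] small|%:R <= tau * #|{: X * X}|%:R.
    by rewrite cardsX cardsT natrM XX mulrCA ler_wpM2l ?ler0n.
  have irrj : #|irregular_pairs c eta (F j)|%:R <= tau * #|{: X * X}|%:R.
    by apply: le_trans (irr j) _; rewrite ler_wpM2r ?ler0n.
  have sp := card_sparse_le c (F j) (ltW tau0); rewrite -/(sparse j) in sp.
  have cU (A B : {set X * X}) : #|A :|: B|%:R <= #|A|%:R + #|B|%:R :> R.
    by rewrite -natrD ler_nat cardsU leq_subr.
  apply: le_trans (cU _ _) _.
  have := cU (irregular_pairs c eta (F j)) (sparse j).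
  have := cU (setX small [set: X]) (setX [set: X] small).
  have : tau * 4 * #|{: X * X}|%:R <= eps * #|{: X * X}|%:R.
    by rewrite ler_wpM2r ?ler0n.
  lra.
have [/existsP[j gD]|] := boolP [exists j, (g (s j), g (t j)) \in
   irregular_pairs c eta (F j) :|: sparse j
   :|: (setX small [set: X] :|: setX [set: X] small)]; first by exists j.
rewrite negb_exists => /forallP good; exfalso; move: few; apply/negP; rewrite -leNgt.
(* A vertex on no arc may have its image in a small cell, since no pair is removed
   because of it; it is left free to take all values. *)
pose A v := if [exists j, (s j == v) || (t j == v)] then cell c (c (g v)) else [set: X].
pose d j := density R c (F j) (c (g (s j))) (c (g (t j))).
have As j : A (s j) = cell c (c (g (s j))).
  by rewrite /A ifT //; apply/existsP; exists j; rewrite eqxx.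
have At j : A (t j) = cell c (c (g (t j))).
  by rewrite /A ifT //; apply/existsP; exists j; rewrite eqxx orbT.
have {}good j : [/\ regular_pair (F j) eta (d j) (A (s j)) (A (t j)),
    tau <= d j, beta * #|X|%:R <= #|A (s j)|%:R & beta * #|X|%:R <= #|A (t j)|%:R].
  have := good j; rewrite !inE /= !negb_or andbT negbK -!leNgt.
  have := holds j; rewrite /arcs_hold => -> /=; rewrite -leNgt -As -At.
  by case/andP => /andP[-> ->] /andP[-> ->].
have bigA v : beta * #|X|%:R <= #|A v|%:R.
  have [/existsP[j /orP[] /eqP<-]|no] := boolP [exists j, (s j == v) || (t j == v)].
  - by have [] := good j.
  - by have [] := good j.
  by rewrite /A (negPf no) cardsT ler_piMl ?ler0n.
have d01 j : 0 <= d j <= 1 by rewrite density_ge0 density_le1.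
have regj j : regular_pair (F j) eta (d j) (A (s j)) (A (t j)) by have [] := good j.
have count := counting simple d01 regj.
apply: (@le_trans _ _ #|[set g in family A | [forall j, arcs_hold s t F g j]]|%:R).
  2: by rewrite ler_nat; apply/subset_leq_card/subsetP => h; rewrite !inE => /andP[].
apply: le_trans count.
have prodA : (beta * #|X|%:R) ^+ #|V| <= (\prod_v #|A v|)%:R.
  rewrite natr_prod -prodr_const; apply: ler_prod => v _.
  by rewrite bigA mulr_ge0 ?ler0n // ltW.
have prodd : tau ^+ #|J| <= \prod_j d j.
  rewrite -prodr_const; apply: ler_prod => j _.
  by have [_ -> _ _] := good j; rewrite ltW.
rewrite -[leLHS]mulrA -exprMn.
apply: ler_pM => //.
- by rewrite divr_ge0 // exprn_ge0 // ltW.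
- by rewrite exprn_ge0 // mulr_ge0 ?ler0n // ltW.
- lra.
Qed.

(** * Removal for prescribed differences *)

(** The set [E j] of removed differences consists of the [y] for which at least
[1 / #|J|] of the [#|G|] pairs [(a, a + y)] lie in [D j].  Each of the [#|G|]
translates of a surviving [g] needs a pair in some [D j], while each [j] provides
fewer than [#|G| / #|J|] of them. *)
Theorem difference_removal (R : archiRealFieldType) (V J : finType) (s t : J -> V)
    (eps : R) :
    simple_arcs s t -> 0 < eps ->
  exists2 delta : R, 0 < delta & forall (G : finZmodType) (B : J -> {set G}),
    #|[set g : {ffun V -> G} | [forall j, g (t j) - g (s j) \in B j]]|%:R
      < delta * #|G|%:R ^+ #|V| ->
    exists E : J -> {set G},
      (forall j, #|E j|%:R <= eps * #|G|%:R) /\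
      forall g : {ffun V -> G},
        ~~ [forall j, g (t j) - g (s j) \in B j :\: E j].
Proof.
move=> simple eps0.
have eps'0 : 0 < eps / #|J|.+1%:R by rewrite divr_gt0 ?ltr0n.
have [delta delta0 rem] := removal simple eps'0.
exists delta => // G B few.
have [D [cardD hitD]] := rem G (fun j x y => y - x \in B j) few.
(* The positions of difference [y] that are removed for [j]. *)
pose bad j y := [set x | (x, x + y) \in D j].
pose E j := [set y | (#|G| <= #|J| * #|bad j y|)%N].
have G0 : (0 < #|G|)%N by apply/card_gt0P; exists 0.
have sum_bad j : (\sum_y #|bad j y| = #|D j|)%N.
  rewrite -[RHS]sum1_card (partition_big (fun z => z.2 - z.1) xpredT) //=.
  apply: eq_bigr => y _; rewrite -sum1dep_card.
  rewrite [RHS](reindex_onto (fun x => (x, x + y)) (fun z => z.1)) /=.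
    by apply: eq_bigl => x; rewrite [x + y]addrC addrK !eqxx !andbT addrC.
  by move=> [x x'] /= /andP[_ /eqP<-]; rewrite addrC subrK.
exists E; split=> [j|g].
  have : (#|E j| * #|G| <= #|J| * #|D j|)%N.
    rewrite -sum_bad big_distrr /= -sum_nat_const.
    rewrite [leqRHS](bigID [in E j]) /=; apply: leq_trans (leq_addr _ _).
    by apply: leq_sum => y; rewrite inE.
  rewrite -(ler_nat R) !natrM => /le_trans le.
  rewrite -(ler_pM2r (x := #|G|%:R)) ?ltr0n //; apply: le.
  apply: (@le_trans _ _ (#|J|%:R * (eps / #|J|.+1%:R * #|{: G * G}|%:R))).
    by rewrite ler_wpM2l ?ler0n.
  rewrite card_prod natrM; set N := #|G|%:R; set n := _%:R^-1.
  have -> : #|J|%:R * (eps * n * (N * N)) = #|J|%:R * n * (eps * N * N) by ring.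
  rewrite ler_piMl ?mulr_ge0 ?ler0n ?(ltW eps0) // /n.
  by rewrite ler_pdivrMr ?ltr0n // mul1r ler_nat.
apply/negP => /forallP inBE.
have hits a : exists j, a \in [set a | (g (s j) + a, g (t j) + a) \in D j].
  have [j|j] := hitD [ffun v => g v + a].
    rewrite /arcs_hold !ffunE opprD addrACA subrr addr0.
    by have := inBE j; rewrite inE => /andP[].
  by rewrite !ffunE => inD; exists j; rewrite inE.
pose y j := g (t j) - g (s j).
have cover : (#|G| <= \sum_j #|bad j (y j)|)%N.
  rewrite -cardsT.
  apply: (@leq_trans #|\bigcup_j [set a | (g (s j) + a, g (t j) + a) \in D j]|).
    apply/subset_leq_card/subsetP => a _.
    by have [j aj] := hits a; apply/bigcupP; exists j.
  elim/big_rec2: _ => [|j n U _ le]; first by rewrite cards0.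
  apply: leq_trans (leq_card_setU _ _) _; apply: leq_add le.
  rewrite -(card_imset _ (addrI (g (s j)))); apply/subset_leq_card/subsetP => x.
  case/imsetP => a; rewrite !inE => aD ->.
  by rewrite [_ + y j]addrC addrA subrK.
have small j : (#|J| * #|bad j (y j)| < #|G|)%N.
  by have := inBE j; rewrite !inE -ltnNge => /andP[].
have [j0 _|noJ] := pickP (fun j : J => true); last first.
  by move: cover; rewrite big_pred0 // leqNgt G0.
have : (\sum_(j : J) #|J| * #|bad j (y j)| < \sum_(j : J) #|G|)%N.
  rewrite (bigD1 j0) //= [ltnRHS](bigD1 j0) //= -addSn leq_add //.
  by apply: leq_sum => j _; apply: ltnW.
by rewrite -big_distrr sum_nat_const /= ltnNge leq_mul.
Qed.

(** * Cycles and potentials *)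

Definition step_value m (G : zmodType) (x : 'I_m -> G) (s : step m) : G :=
  if s.2 then x s.1 else - x s.1.

(** [char_vec] with integer entries, so that it can act on any abelian group. *)
Definition cycle_vec m (c : seq (step m)) : 'rV[int]_m :=
  \row_(j < m) (((j, true) \in c)%:R - ((j, false) \in c)%:R).

Lemma rat_cycle_vec m (c : seq (step m)) : rat_vec (cycle_vec c) = char_vec c.
Proof. by apply/rowP => j; rewrite !mxE rmorphB /= !rmorph_nat. Qed.

Lemma sum_cycle_vec m (G : zmodType) (x : 'I_m -> G) (c : seq (step m)) :
  uniq c -> \sum_j x j *~ cycle_vec c 0 j = \sum_(s <- c) step_value x s.
Proof.
move=> uc; rewrite (big_uniq _ uc) /= [RHS]big_mkcond /=.
transitivity (\sum_j \sum_b if (j, b) \in c then step_value x (j, b) else 0).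
  apply: eq_bigr => j _; rewrite big_bool /= mxE /step_value /=.
  by do 2!case: (_ \in c); rewrite ?addr0 ?add0r ?subrr ?subr0 ?sub0r ?mulrNz ?mulr1z ?mulr0z.
by rewrite pair_bigA; apply: eq_bigr => -[].
Qed.

Section Potentials.
Variables (m : nat) (H : digraph m).

Definition follows (s t : step m) := step_to H s == step_from H t.

Lemma uniq_is_cycle c : is_cycle H c -> uniq c.
Proof. by case/and4P => _ _ _ /map_uniq. Qed.

Lemma perm_cycle_ends c : is_cycle H c ->
  perm_eq [seq step_to H s | s <- c] [seq step_from H s | s <- c].
Proof.
case/and4P; case: c => // s c _ + _ _.
rewrite (_ : cycle _ _ = path follows s (rcons c s)) // => walk.
have shift u p : path follows u p ->
    [seq step_to H w | w <- belast u p] = [seq step_from H w | w <- p].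
  by elim: p u => //= w p IH u /andP[/eqP-> /IH->].
have := shift _ _ walk; rewrite belast_rcons => ->.
by rewrite perm_map // perm_rcons.
Qed.

(** Along a cycle each vertex is entered as often as it is left. *)
Lemma cycle_vec_conserved c v : is_cycle H c ->
  \sum_j ((target H j == v)%:R - (source H j == v)%:R : rat) * char_vec c 0 j = 0.
Proof.
move=> cyc.
pose h j : rat := (target H j == v)%:R - (source H j == v)%:R.
rewrite (eq_bigr (fun j => h j *~ cycle_vec c 0 j)); last first.
  by move=> j _; rewrite -rat_cycle_vec !mxE mulrzr.
rewrite (sum_cycle_vec h (uniq_is_cycle cyc)).
rewrite (eq_bigr (fun s => (step_to H s == v)%:R - (step_from H s == v)%:R)).
  rewrite sumrB -(big_map (step_to H) xpredT (fun u => (u == v)%:R)).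
  rewrite -(big_map (step_from H) xpredT (fun u => (u == v)%:R)).
  by rewrite (perm_big _ (perm_cycle_ends cyc)) subrr.
by move=> [j []] _; rewrite /step_value /step_to /step_from /h //= opprB.
Qed.

Lemma cycle_space_conserved (z : 'rV[rat]_m) v : z \in cycle_space H ->
  \sum_j ((target H j == v)%:R - (source H j == v)%:R : rat) * z 0 j = 0.
Proof.
pose b : 'cV[rat]_m := \col_j ((target H j == v)%:R - (source H j == v)%:R).
have dotE (y : 'rV[rat]_m) :
    (y \in lker (linfun (mulmxr b))) =
    (\sum_j ((target H j == v)%:R - (source H j == v)%:R : rat) * y 0 j == 0).
  rewrite memv_ker lfunE /=; apply/eqP/eqP => [/matrixP/(_ 0 0)|y0].
    by rewrite !mxE => y0; rewrite -[RHS]y0; apply: eq_bigr => j _; rewrite mxE mulrC.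
  apply/matrixP => i k; rewrite !mxE -[RHS]y0.
  by apply: eq_bigr => j _; rewrite mxE mulrC !ord1.
move=> zC; apply/eqP; rewrite -dotE; apply: subvP zC.
by apply/cycle_spaceP => c cyc; rewrite dotE cycle_vec_conserved.
Qed.

Variables (G : zmodType) (x : 'I_m -> G).

Definition is_potential_on (g : vertex H -> G) (r : seq 'I_m) : Prop :=
  forall j, j \in r -> x j = g (target H j) - g (source H j).

Definition joined (r : seq 'I_m) (u v : vertex H) : bool :=
  [exists s : step m, [&& s.1 \in r, step_from H s == u & step_to H s == v]].

Lemma joined_sym r : symmetric (joined r).
Proof.
have flip u v : joined r u v -> joined r v u.
  case/existsP => -[j b] /and3P[/= jr fu tv].
  apply/existsP; exists (j, ~~ b); rewrite /= jr.
  by move: fu tv; rewrite /step_from /step_to; case: b => /= -> ->.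
by move=> u v; apply/idP/idP => /flip.
Qed.

(** As the vertices of the path are distinct, the walk uses no arc twice.  The last
clause is what closes the walk into a cycle with an arc from [last v p] to [v]. *)
Lemma steps_of_path g r v p : is_potential_on g r ->
    path (joined r) v p -> uniq (v :: p) ->
  exists c : seq (step m),
    [/\ [seq step_from H s | s <- c] = belast v p /\ [seq step_to H s | s <- c] = p,
        {subset [seq s.1 | s <- c] <= r},
        uniq [seq s.1 | s <- c],
        \sum_(s <- c) step_value x s = g (last v p) - g v &
        forall s t, step_to H s = v -> step_from H t = last v p ->
          path follows s (rcons c t)].
Proof.
move=> pot; elim: p v => [|w p IH] v /=.
  move=> _ _; exists [::]; split=> //=; first by rewrite big_nil subrr.
  by move=> s t sv tv; rewrite /follows sv tv eqxx.
case/andP => /existsP[s /and3P[sr /eqP sv /eqP sw]] walk /andP[vwp uwp].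
have [c [[fromc toc] cr uc sumc pathc]] := IH w walk uwp.
exists (s :: c); split=> /=.
- by rewrite sv sw fromc toc.
- by move=> j; rewrite inE => /predU1P[->//|]; apply: cr.
- rewrite uc andbT; apply/negP => /mapP[s' s'c ss'].
  have fs' : step_from H s' \in w :: p.
    have := map_f (step_from H) s'c; rewrite fromc; exact: mem_belast.
  have ts' : step_to H s' \in w :: p.
    by have := map_f (step_to H) s'c; rewrite toc inE => ->; rewrite orbT.
  move: fs' ts' (negP vwp); rewrite -sv /step_from /step_to -ss'.
  by case: (s.2); case: (s'.2) => ? ? [].
- rewrite big_cons sumc (_ : step_value x s = g w - g v); first by rewrite addrC subrKA.
  rewrite /step_value (pot _ sr) -sv -sw /step_from /step_to.
  by case: ifP; rewrite ?opprB.
- move=> s0 t sv0 tl; rewrite /follows sv0 sv eqxx /=.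
  exact: pathc.
Qed.

(** The arcs are added one at a time.  If the ends of the new arc [j] are not yet
connected, the potential is shifted by a constant on the component of
[target j].  Otherwise a path from [target j] back to [source j] closes with [j]
to a cycle, on which [x] sums to zero, so the potential already fits [j]. *)
Lemma exists_potential :
    (forall c, is_cycle H c -> \sum_(s <- c) step_value x s = 0) ->
  exists g : vertex H -> G, forall j, x j = g (target H j) - g (source H j).
Proof.
move=> cyc0.
suff [g pot] : exists g, is_potential_on g (enum 'I_m).
  by exists g => j; apply: pot; rewrite mem_enum.
elim: (enum 'I_m) (enum_uniq 'I_m) => [|j r IH] /=; first by exists (fun=> 0).
case/andP => jr /IH[g pot].
have symc := sym_connect_sym (joined_sym r).
have [con|ncon] := boolP (connect (joined r) (target H j) (source H j)).
  exists g => i; rewrite inE => /predU1P[->|]; last exact: pot.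
  have /connectP[p0 walk0 last0] := con.
  case: (shortenP walk0) last0 => p walk up _ last0.
  have [c [[fromc toc] cr uc sumc pathc]] := steps_of_path pot walk up.
  have /cyc0 : is_cycle H ((j, true) :: c).
    apply/and4P; split=> //=.
    - by apply: pathc; rewrite // -last0.
    - rewrite fromc [step_from H _]last0.
      by rewrite -rcons_uniq -lastI.
    - by rewrite uc andbT; apply: contra jr => /cr.
  rewrite big_cons sumc -last0 /step_value /= => /eqP; rewrite addr_eq0 opprB.
  by move/eqP.
pose a := x j - (g (target H j) - g (source H j)).
exists (fun v => g v + (if connect (joined r) (target H j) v then a else 0)) => i.
rewrite inE => /predU1P[->|ir].
  by rewrite connect0 (negPf ncon) addr0 /a addrAC addrC subrK.
have st : joined r (source H i) (target H i).
  by apply/existsP; exists (i, true); rewrite /= ir !eqxx.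
rewrite (same_connect_r symc (connect1 st)) (pot _ ir).
by rewrite opprD addrACA subrr addr0.
Qed.

End Potentials.

(** * Solutions and potentials *)

Section FiniteFibres.
Variables (I K : finType) (G : finZmodType) (phi : {ffun I -> G} -> {ffun K -> G}).
Hypothesis phiB : {morph phi : x y / x - y}.

Lemma card_fibre x0 : #|[set x | phi x == phi x0]| = #|[set x | phi x == 0]|.
Proof.
rewrite -[RHS](card_imset _ (addIr x0)); apply: eq_card => x.
rewrite inE; apply/eqP/imsetP => [phix|[z + ->]].
  by exists (x - x0); rewrite ?subrK // inE phiB phix subrr.
have phi0 : phi 0 = 0 by rewrite -(subrr 0) phiB subrr.
have phiN y : phi (- y) = - phi y by rewrite -sub0r phiB phi0 sub0r.
by rewrite inE -[x0 in phi (z + x0)]opprK phiB phiN opprK => /eqP->; rewrite add0r.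
Qed.

Lemma card_kernel_ge : (#|G| ^ (#|I| - #|K|) <= #|[set x | phi x == 0%R]|)%N.
Proof.
have G0 : (0 < #|G|)%N by apply/card_gt0P; exists 0.
have fibre_le y : (#|[set x | phi x == y]| <= #|[set x | phi x == 0%R]|)%N.
  have [->|[x0]] := set_0Vmem [set x | phi x == y]; first by rewrite cards0.
  by rewrite inE => /eqP<-; rewrite card_fibre.
have [IK|/ltnW IK] := leqP #|K| #|I|; last first.
  rewrite (eqnP IK) expn0; apply: leq_trans (fibre_le (phi 0)).
  by apply/card_gt0P; exists 0; rewrite inE.
rewrite -(leq_pmul2r (m := #|G| ^ #|K|)) ?expn_gt0 ?G0 // -expnD subnK //.
rewrite -!card_ffun -[leqLHS]sum1_card (partition_big phi xpredT) //= mulnC.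
rewrite -sum_nat_const.
by apply: leq_sum => y _; rewrite sum1dep_card fibre_le.
Qed.

End FiniteFibres.

Section Representation.
Variables (k m : nat) (eps : 'M[int]_(k, m)) (H : digraph m).
Hypothesis gen : integrally_generates [tuple row i eps | i < k] (cycle_space H).

(** This is where the generation has to be integral: a rational combination of the
equations need not vanish on a solution in [G]. *)
Lemma potential_of_solution (G : zmodType) (x : 'I_m -> G) :
    (forall i, \sum_j x j *~ eps i j = 0) ->
  exists g : vertex H -> G, forall j, x j = g (target H j) - g (source H j).
Proof.
move=> solx; apply: exists_potential => c cyc.
have [_ _ spans] := gen.
have inC : rat_vec (cycle_vec c) \in cycle_space H.
  by rewrite rat_cycle_vec; have /cycle_spaceP := subvv (cycle_space H); apply.
have [a ca] := spans _ inC.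
rewrite -(sum_cycle_vec x (uniq_is_cycle cyc)) ca.
rewrite (eq_bigr (fun j => \sum_i x j *~ eps i j *~ a i)) => [|j _]; last first.
  rewrite summxE mulrz_sumr; apply: eq_bigr => i _.
  by rewrite tnth_mktuple !mxE mulrC mulrzA.
rewrite exchange_big big1 // => i _.
by rewrite -mulrz_suml solx mul0rz.
Qed.

Lemma solution_of_potential (G : zmodType) (g : vertex H -> G) i :
  \sum_j (g (target H j) - g (source H j)) *~ eps i j = 0.
Proof.
have [inC _ _] := gen.
pose b v j : int := (target H j == v)%:R - (source H j == v)%:R.
have conserved v : \sum_j b v j * eps i j = 0.
  have := cycle_space_conserved v (inC i); rewrite tnth_mktuple => sum0.
  apply: (@intr_inj rat); rewrite rmorph_sum -[RHS]sum0 /=.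
  by apply: eq_bigr => j _; rewrite !mxE rmorphM rmorphB /= !rmorph_nat.
rewrite (eq_bigr (fun j => \sum_v g v *~ (b v j * eps i j))) => [|j _].
  by rewrite exchange_big big1 // => v _; rewrite -mulrz_sumr conserved.
have pick u : g u = \sum_v g v *~ (u == v)%:R.
  rewrite (bigD1 u) //= eqxx mulr1z big1 ?addr0 // => v.
  by rewrite eq_sym => /negPf->.
rewrite [X in X - _]pick [X in _ - X]pick -sumrB mulrz_suml.
by apply: eq_bigr => v _; rewrite mulrzA mulrzBr.
Qed.

Variable G : finZmodType.
Implicit Types (A : 'I_m -> {set G}) (g : {ffun vertex H -> G}).

Definition differences g : {ffun 'I_m -> G} :=
  [ffun j => g (target H j) - g (source H j)].

Definition potentials A : {set {ffun vertex H -> G}} :=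
  [set g | [forall j, differences g j \in A j]].

Lemma differencesB : {morph differences : g h / g - h}.
Proof.
by move=> g h; apply/ffunP => j; rewrite !ffunE !opprD addrACA !opprK.
Qed.

Lemma solution_has_potential A x : x \in solutions eps A ->
  exists g, x = differences g.
Proof.
rewrite inE => /andP[_ /forallP solx].
have [g gx] := potential_of_solution (fun i => eqP (solx i)).
by exists [ffun v => g v]; apply/ffunP => j; rewrite !ffunE.
Qed.

Lemma card_potentials A :
  (#|potentials A| = #|solutions eps A| * #|[set g | differences g == 0%R]|)%N.
Proof.
rewrite -sum1_card (partition_big differences [in solutions eps A]) /= => [|g].
  rewrite -sum_nat_const; apply: eq_bigr => x xsol.
  have [g0 xg0] := solution_has_potential xsol.
  rewrite -(card_fibre differencesB g0) -xg0 sum1dep_card; apply: eq_card => g.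
  rewrite !inE andb_idl // => /eqP->.
  by move: xsol; rewrite inE => /andP[].
rewrite !inE => -> /=; apply/forallP => i; apply/eqP.
rewrite -[RHS](solution_of_potential g i).
by apply: eq_bigr => j _; rewrite ffunE.
Qed.

Lemma card_solutions_full :
  (#|G| ^ (m - k) <= #|solutions eps (fun=> [set: G])|)%N.
Proof.
pose phi (x : {ffun 'I_m -> G}) : {ffun 'I_k -> G} :=
  [ffun i => \sum_j x j *~ eps i j].
have phiB : {morph phi : x y / x - y}.
  move=> x y; apply/ffunP => i; rewrite !ffunE -sumrB.
  by apply: eq_bigr => j _; rewrite !ffunE mulrzBl.
have := card_kernel_ge phiB; rewrite !card_ord => /leq_trans; apply.
apply/subset_leq_card/subsetP => x; rewrite !inE => /eqP phix.
apply/andP; split; apply/forallP => i; rewrite ?inE //.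
by have /ffunP/(_ i) := phix; rewrite !ffunE => ->.
Qed.

(** Each solution has [kappa] potentials, and the system has at least
[#|G| ^ (m - k)] solutions in all, so there are at least [kappa * #|G| ^ (m - k)]
maps from the vertices to [G].  This avoids computing the dimension of the cycle
space from the number of components of [H]. *)
Lemma potentials_lt (R : realFieldType) (delta : R) A : 0 < delta ->
    #|solutions eps A|%:R < delta * #|G|%:R ^+ (m - k) ->
  #|potentials A|%:R < delta * #|G|%:R ^+ #|vertex H|.
Proof.
move=> delta0 few.
pose kappa := #|[set g | differences g == 0]|.
have kappa0 : (0 < kappa)%N.
  apply/card_gt0P; exists 0; rewrite inE; apply/eqP/ffunP => j.
  by rewrite !ffunE subrr.
apply: (@lt_le_trans _ _ (delta * #|G|%:R ^+ (m - k) * kappa%:R)).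
  by rewrite card_potentials natrM ltr_pM2r ?ltr0n.
rewrite -mulrA ler_wpM2l ?(ltW delta0) // -!natrX -natrM ler_nat.
apply: (@leq_trans #|potentials (fun=> [set: G])|).
  by rewrite card_potentials leq_mul // card_solutions_full.
by rewrite (leq_trans (max_card _)) ?card_ffun.
Qed.

End Representation.

(** * Loops and parallel arcs *)

Section ParallelArcs.
Variables (m : nat) (H : digraph m).

Definition ascending (j : 'I_m) : bool :=
  (enum_rank (source H j) < enum_rank (target H j))%N.

(** A class of parallel arcs is represented by its ends, listed in the order of the
enumeration of the vertices, so that opposite arcs fall into the same class. *)
Definition sorted_ends (j : 'I_m) : vertex H * vertex H :=
  if ascending j then (source H j, target H j) else (target H j, source H j).

Definition nonloop (j : 'I_m) : bool := source H j != target H j.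

Definition edge : finType :=
  {p : vertex H * vertex H | [exists j, nonloop j && (sorted_ends j == p)]}.

Definition low_end (p : edge) : vertex H := (val p).1.
Definition high_end (p : edge) : vertex H := (val p).2.

Lemma edge_ascending (p : edge) :
  (enum_rank (low_end p) < enum_rank (high_end p))%N.
Proof.
have /existsP[j /andP[nl /eqP jp]] := valP p.
rewrite /low_end /high_end -jp /sorted_ends.
case: ifP => //=; rewrite /ascending => /negbT; rewrite -leqNgt leq_eqVlt.
case/predU1P => // /ord_inj/enum_rank_inj ts.
by move: nl; rewrite /nonloop ts eqxx.
Qed.

Lemma simple_edges : simple_arcs low_end high_end.
Proof.
split=> [p|p q].
  by apply/eqP => lh; have := edge_ascending p; rewrite lh ltnn.
apply: contraNN; rewrite !inE.
have := edge_ascending p; have := edge_ascending q.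
have endsE (e : edge) : val e = (low_end e, high_end e) by apply: surjective_pairing.
rewrite -val_eqE !endsE xpair_eqE => lq lp.
case/andP => /orP[] /eqP lowp /orP[] /eqP highp.
- by move: lp; rewrite lowp highp ltnn.
- by rewrite lowp highp !eqxx.
- by move: lp; rewrite lowp highp ltnNge ltnW.
- by move: lp; rewrite lowp highp ltnn.
Qed.

Variable G : finZmodType.

(** Turns a value on the arc [j] into a value on its edge, and back. *)
Definition orient (j : 'I_m) (y : G) : G := if ascending j then y else - y.

Lemma orientK j : involutive (orient j).
Proof. by move=> y; rewrite /orient; case: ascending; rewrite ?opprK. Qed.

Lemma orient_difference (g : vertex H -> G) j :
  orient j (g (target H j) - g (source H j)) =
  g (sorted_ends j).2 - g (sorted_ends j).1.
Proof. by rewrite /orient /sorted_ends; case: ifP => //=; rewrite opprB. Qed.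

End ParallelArcs.

(** An edge carries the intersection [B p] of the sets of its arcs, reversed where
needed; what is removed from [B p] is removed from the set of each of these arcs.
Only pairs joined by an arc are edges, because nothing could be removed on behalf
of another pair. *)
Theorem system_removal (R : archiRealFieldType) (k m : nat) (eps : 'M[int]_(k, m))
    (eta : R) :
    graph_representable eps -> 0 < eta ->
  exists2 delta : R, 0 < delta & forall (G : finZmodType) (A : 'I_m -> {set G}),
    #|solutions eps A|%:R < delta * #|G|%:R ^+ (m - k) ->
    exists A' : 'I_m -> {set G},
      [/\ forall i, A' i \subset A i,
          forall i, #|A i :\: A' i|%:R <= eta * #|G|%:R &
          forall x, x \notin solutions eps A'].
Proof.
case=> H gen eta0.
have [delta delta0 rem] := difference_removal (@simple_edges m H) eta0.
exists delta => // G A few.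
have solP A0 x : x \in solutions eps A0 ->
    exists g : vertex H -> G, forall j,
      x j = g (target H j) - g (source H j) /\ x j \in A0 j.
  move=> xsol; have [g xg] := solution_has_potential gen xsol.
  exists g => j; split; first by rewrite xg ffunE.
  by move: xsol; rewrite inE => /andP[/forallP].
(* On a loop every solution is [0]. *)
have [/existsP[j0 /andP[loop0 A0]]|loops] :=
    boolP [exists j, ~~ nonloop H j && (0 \notin A j)].
  exists A; split=> // [i|x].
    by rewrite setDv cards0 mulr_ge0 ?ler0n // ltW.
  apply/negP => /solP[g /(_ j0)[xg xA]]; move: xA A0; rewrite xg.
  by move: loop0; rewrite negbK => /eqP->; rewrite subrr => ->.
pose B (p : edge H) := [set y : G | [forall j,
  nonloop H j && (sorted_ends H j == val p) ==> (orient H j y \in A j)]].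
have [|E [cardE noE]] := rem G B.
  apply: le_lt_trans (potentials_lt gen delta0 few).
  rewrite ler_nat; apply/subset_leq_card/subsetP => g; rewrite !inE => /forallP gB.
  apply/forallP => j; rewrite ffunE.
  have [nl|] := boolP (nonloop H j).
    have ej : [exists i, nonloop H i && (sorted_ends H i == sorted_ends H j)].
      by apply/existsP; exists j; rewrite nl eqxx.
    have := gB (exist _ (sorted_ends H j) ej); rewrite inE => /forallP/(_ j).
    by rewrite nl eqxx /= -orient_difference orientK.
  move=> lj; move: loops; rewrite negb_exists => /forallP/(_ j).
  rewrite lj /= negbK; move: lj; rewrite negbK => /eqP->.
  by rewrite subrr.
pose A' j := [set y in A j | [forall p : edge H,
  nonloop H j && (sorted_ends H j == val p) ==> (orient H j y \notin E p)]].
exists A'; split=> [j|j|x].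
- by apply/subsetP => y; rewrite inE => /andP[].
- have [->|[y0]] := set_0Vmem (A j :\: A' j).
    by rewrite cards0 mulr_ge0 ?ler0n // ltW.
  rewrite !inE => /andP[+ Ay0]; rewrite Ay0 /= negb_forall => /existsP[p].
  rewrite negb_imply => /andP[/andP[nl /eqP jp] _].
  apply: le_trans (cardE p); rewrite ler_nat.
  rewrite -(card_imset _ (inv_inj (orientK H j))).
  apply/subset_leq_card/subsetP => y; rewrite !inE => /andP[+ Ay].
  rewrite Ay /= negb_forall => /existsP[q].
  rewrite negb_imply negbK => /andP[/andP[_ /eqP jq] Eqy].
  apply/imsetP; exists (orient H j y); rewrite ?orientK //.
  by rewrite (_ : p = q) //; apply: val_inj; exact: (etrans (esym jp) jq).
apply/negP => /solP[g xg].
have /negP := noE [ffun v => g v]; apply; apply/forallP => p.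
have diffE j : sorted_ends H j == val p ->
    orient H j (x j) = [ffun v => g v] (high_end p) - [ffun v => g v] (low_end p).
  move=> /eqP jp; have [-> _] := xg j.
  by rewrite orient_difference !ffunE /high_end /low_end jp.
rewrite !inE; apply/andP; split.
  have /existsP[j /andP[nl jp]] := valP p.
  rewrite -(diffE j jp); have [_] := xg j; rewrite inE => /andP[_ /forallP/(_ p)].
  by rewrite nl jp.
apply/forallP => j; apply/implyP => /andP[nl jp].
by rewrite -(diffE j jp) orientK; have [_] := xg j; rewrite inE => /andP[].
Qed.

(** * From thresholds to a function of delta *)

Local Open Scope classical_set_scope.
Local Open Scope ring_scope.

(** [f d] exceeds the infimum of the [e] with [P d e], so [P d (f d)] holds by
monotonicity, and it exceeds it only by [d], so [f] still tends to [0]. *)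
Lemma modulus_of_thresholds (R : realType) (P : R -> R -> Prop) :
    (forall d d' e, d' <= d -> P d e -> P d' e) ->
    (forall d e e', e <= e' -> P d e -> P d e') ->
    (forall d, 0 < d -> P d 1) ->
    (forall e, 0 < e -> exists2 d, 0 < d & P d e) ->
  exists f : R -> R,
    f d @[d --> (0 : R)^'+] --> (0 : R) /\ forall d, 0 < d -> P d (f d).
Proof.
move=> anti mono P1 small.
pose S d := [set e | 0 < e /\ P d e].
have lb0 d : lbound (S d) 0 by move=> e [/ltW].
have infS d : 0 < d -> has_inf (S d).
  by move=> d0; split; [exists 1; split=> //; exact: P1|exists 0].
exists (fun d => inf (S d) + d); split; last first.
  move=> d d0; have [e [_ Pe] lt] := inf_adherent d0 (infS d d0).
  exact: mono (ltW lt) Pe.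
apply/cvgrPdist_lt => e e0.
have e20 : 0 < e / 2 by rewrite divr_gt0.
have [d0 d00 Pd0] := small _ e20.
near=> d.
have d_gt0 : 0 < d by near: d; exact: nbhs_right_gt.
have d_lte : d < e / 2 by near: d; exact: nbhs_right_lt.
have d_ltd0 : d < d0 by near: d; exact: nbhs_right_lt.
have inf0 : 0 <= inf (S d) by apply: lb_le_inf => //; have [] := infS d d_gt0.
have infe : inf (S d) <= e / 2.
  by apply: ge_inf; [exists 0|split=> //; exact: anti (ltW d_ltd0) Pd0].
rewrite sub0r normrN ger0_norm ?addr_ge0 ?(ltW d_gt0) //.
by rewrite [ltRHS]splitr ler_ltD.
Unshelve. all: by end_near. Qed.

Theorem theorem3 (R : realType) (k m : nat) (eps : 'M[int]_(k, m)) :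
  (1 <= k)%N -> (2 <= m)%N ->
  (forall i j, eps i j \in [:: -1; 0; 1]) ->
  graph_representable eps ->
  exists delta' : R -> R,
    delta' d @[d --> (0 : R)^'+] --> (0 : R) /\
    forall delta : R, 0 < delta ->
    forall (G : finZmodType) (A : 'I_m -> {set G}),
      #|solutions eps A|%:R < delta * #|G|%:R ^+ (m - k) ->
      exists A' : 'I_m -> {set G},
        [/\ forall i, A' i \subset A i,
            forall i, #|A i :\: A' i|%:R <= delta' delta * #|G|%:R &
            forall x, x \notin solutions eps A'].
Proof.
move=> _ m2 _ graph.
apply: (@modulus_of_thresholds R (fun delta eta =>
  forall (G : finZmodType) (A : 'I_m -> {set G}),
    #|solutions eps A|%:R < delta * #|G|%:R ^+ (m - k) ->
    exists A' : 'I_m -> {set G},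
      [/\ forall i, A' i \subset A i,
          forall i, #|A i :\: A' i|%:R <= eta * #|G|%:R &
          forall x, x \notin solutions eps A'])).
- move=> d d' e dd' Pd G A few; apply: Pd; apply: lt_le_trans few _.
  by rewrite ler_wpM2r // exprn_ge0.
- move=> d e e' ee' Pe G A /Pe[A' [sub small none]].
  exists A'; split=> // i; apply: le_trans (small i) _.
  by rewrite ler_wpM2r.
- move=> d _ G A _; exists (fun=> finset.set0); split=> [i|i|x].
  + exact: finset.sub0set.
  + by rewrite mul1r ler_nat max_card.
  rewrite inE negb_and; apply/orP; left; apply/forallP => /(_ (Ordinal (ltnW m2))).
  by rewrite inE.
move=> e e0; exact: system_removal graph e0.
Qed.
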